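(* Let $n$ be a positive integer and $G=\mathrm{D}_{2n}$. Then $$h(G)=\begin{cases} n=|G'| & \text{if } n \text{ is odd},\\ \frac{n^2}{4}=|G'|^2 & \text{if } n\text{ is even}.\end{cases}$$
   Context: For a finite group $G$ with conjugacy classes $K_1,\dots,K_s$ and irreducible complex characters $\chi_1,\dots,\chi_s$, Harada's number is $h(G)=\frac{|K_1|\cdots|K_s|}{\chi_1(1)\cdots\chi_s(1)}$. $G'$ denotes the commutator subgroup of $G$. The dihedral group of order $2n$ is $\mathrm{D}_{2n}=\langle\sigma,\tau\mid\sigma^n=\tau^2=1,\ \sigma^\tau=\sigma^{-1}\rangle$, where $y^x=x^{-1}yx$. *)

(* Defs.v *)
From mathcomp Require Import all_boot all_order all_algebra.
From mathcomp Require Import all_fingroup all_solvable all_field all_character.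

Set Implicit Arguments.
Unset Strict Implicit.
Unset Printing Implicit Defensive.

Import GRing.Theory.
Local Open Scope ring_scope.

Definition harada_number (gT : finGroupType) (G : {group gT}) : algC :=
  (\prod_(K in classes G) #|K|)%N%:R / \prod_(i : Iirr G) 'chi[G]_i 1%g.

(* G is dihedral of order 2n, i.e. isomorphic to
   < s, t | s^n = t^2 = 1, t^-1 s t = s^-1 >.
   MathComp's 'D_(2 * n) is not used because it is only meaningful for n > 1
   ('D_2 has order 4, since 'Z_1 is the ring of integers mod 2).
   "\isog Grp" characterizes G by its finite homomorphic images, which is the
   same as being isomorphic to the presented group since the latter is finite
   for n > 0. *)
Definition dihedral (n : nat) (gT : finGroupType) (G : {group gT}) : Prop :=
  (G \isog Grp (s : t : s ^+ n, t ^+ 2, s ^ t = s^-1))%g.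

(* Main.v *)
Require Import Defs.
From mathcomp Require Import all_boot all_order all_algebra.
From mathcomp Require Import all_fingroup all_solvable all_field all_character.
From mathcomp Require Import zify.

Set Implicit Arguments.
Unset Strict Implicit.
Unset Printing Implicit Defensive.

Import GRing.Theory Num.Theory.
Local Open Scope ring_scope.

(** The formula is the case p = 2 of a fact about every finite group G with a
    normal abelian subgroup A of prime index p:
      h(G) = |G'| ^ ((p - 1) |A : G'|)      (harada_abelian_prime_index).

    Fix y in G outside A, so that G is generated by A and y.  As A is abelian,
    a |-> [a, y] is an endomorphism of A; its kernel is the centraliser C of y
    in A, and its image is G' (der1_commg_imset).  Hence |G'| |C| = |A|, that
    is, |C| = |A : G'|.

    Classes: an element of C is central; an element of A outside C has
    centraliser A, hence a class of size p; an element outside A has a class of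
    size |A| / |C| = |G'|.  Counting elements, there are (|A| - |C|) / p classes
    of size p and (|G| - |A|) / |G'| = (p - 1) |C| classes outside A.

    Characters: by Clifford theory each irreducible character of G restricts to
    A as one linear character or as a sum of p of them, so its degree is 1 or p.
    There are |G : G'| = p |C| linear characters and the squares of the degrees
    add up to |G| = p |A|, which leaves (|A| - |C|) / p characters of degree p.

    Therefore the powers of p cancel in h(G) and only the classes outside A
    contribute.

    In the dihedral group A = <s> and p = 2.  There [s^i, t] = s^(-2i), so G' is
    generated by s^2, and |A : G'| = gcd (n, 2), which is 1 or 2 according to
    the parity of n. *)

(** * The derived subgroup of a cyclic extension of an abelian group *)

Section AbelianByCyclic.

Variables (gT : finGroupType) (A G : {group gT}) (y : gT).
Hypotheses (cAA : abelian A) (nAy : y \in 'N(A)%g).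
Hypothesis defG : (A <*> <[y]>)%g = G.

Local Open Scope group_scope.

Lemma commg_right_morph : {in A &, {morph (fun a => [~ a, y]) : a b / a * b}}.
Proof.
move=> a b Aa Ab; rewrite commMgJ; congr (_ * _).
have ARa : [~ a, y] \in A by rewrite commgEl groupM ?groupV ?memJ_norm.
by rewrite conjgE (centsP cAA _ ARa _ Ab) mulKg.
Qed.

(** The image B of a |-> [a, y] is normalised by A, which centralises it, and
    by y, since [a, y] ^ y = [a ^ y, y].  Modulo B the generators A and y
    commute, so G / B is abelian and G' lies in B. *)
Lemma der1_commg_imset : G^`(1) = [set [~ a, y] | a in A].
Proof.
pose f := Morphism commg_right_morph.
have defB : f @* A = [set [~ a, y] | a in A] by rewrite morphimEdom.
rewrite -defB; apply/eqP; rewrite eqEsubset; apply/andP; split; last first.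
  apply/subsetP=> _ /morphimP[a _ Aa ->] /=; rewrite mem_commg -?defG //.
    exact: (subsetP (joing_subl A <[y]>)).
  by apply: (subsetP (joing_subr A <[y]>)); rewrite cycle_id.
have sBA : f @* A \subset A.
  apply/subsetP=> _ /morphimP[a _ Aa ->] /=.
  by rewrite commgEl groupM ?groupV ?memJ_norm.
have nBA : A \subset 'N(f @* A).
  by rewrite cents_norm // centsC (subset_trans sBA).
have nBy : y \in 'N(f @* A).
  rewrite -groupV inE; apply/subsetP=> _ /imsetP[_ /morphimP[a _ Aa ->] ->].
  rewrite [f a ^ _]conjRg (conjgE y) invgK mulgV mulg1.
  by rewrite (mem_morphim f) //= memJ_norm ?groupV.
have cBAy : <[y]> / f @* A \subset 'C(A / f @* A).
  rewrite quotient_cycle // cycle_subG -sub1set -quotient_set1 //.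
  apply: quotient_cents2r; rewrite commGC gen_subG.
  by apply/subsetP=> _ /imset2P[a _ Aa /set1P-> ->]; rewrite (mem_morphim f).
have nBG : G \subset 'N(f @* A) by rewrite -defG join_subG nBA cycle_subG.
rewrite der1_min // -defG quotientY ?cycle_subG // abelianY.
by rewrite !quotient_abelian ?cycle_abelian.
Qed.

(** First isomorphism theorem for a |-> [a, y], whose kernel is 'C_A[y]. *)
Lemma card_der1_cent1 : (#|G^`(1)| * #|'C_A[y]| = #|A|)%N.
Proof.
pose f := Morphism commg_right_morph.
rewrite der1_commg_imset -(morphimEdom f) card_morphim setIid.
suff -> : 'ker f = 'C_A[y] by rewrite mulnC Lagrange ?subsetIl.
apply/setP=> a; rewrite [RHS]inE [LHS]inE; apply: andb_id2l => Aa.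
by rewrite 2!inE; apply/commgP/cent1P.
Qed.

End AbelianByCyclic.

(** * Conjugacy class sizes over an abelian normal subgroup of prime index *)

Section AbelianPrimeIndex.

Local Open Scope group_scope.

Variables (gT : finGroupType) (A G : {group gT}) (p : nat) (y : gT).
Hypotheses (nsAG : (A <| G)) (cAA : abelian A).
Hypotheses (p_pr : prime p) (iGA : #|G : A| = p).
Hypotheses (Gy : y \in G) (notAy : y \notin A).

Let sAG : A \subset G := normal_sub nsAG.
Let nAG : G \subset 'N(A) := normal_norm nsAG.
Let nAy : y \in 'N(A) := subsetP nAG y Gy.

Lemma prime_index_maximal (H : {group gT}) :
  A \proper H -> H \subset G -> H :=: G.
Proof.
case/andP=> sAH not_sHA sHG; apply/eqP; rewrite eqEsubset sHG -indexg_eq1 /=.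
have:= p_pr; rewrite -iGA -(Lagrange_index sHG sAH).
case/primeP=> _ /(_ _ (dvdn_mulr _ (dvdnn _)))/orP[-> // | /eqP/esym].
move/(congr1 (fun k => k %/ #|G : H|)%N); rewrite mulKn // divnn indexg_gt0.
by move=> iHA; case/negP: not_sHA; rewrite -indexg_eq1 iHA.
Qed.

Lemma join_cycle_prime_index : A <*> <[y]> = G.
Proof.
apply: (prime_index_maximal (H := (A <*> <[y]>)%G)).
  rewrite properE joing_subl /=; apply: contra notAy => /subsetP; apply.
  by rewrite (subsetP (joing_subr A <[y]>)) ?cycle_id.
by rewrite join_subG sAG cycle_subG.
Qed.

Lemma cent1_sub_center : ('C_A[y] \subset 'Z(G)).
Proof.
rewrite subsetI subIset ?sAG //= -join_cycle_prime_index centY cent_cycle.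
by rewrite subsetI subsetIr (subset_trans _ cAA) ?subsetIl.
Qed.

Lemma card_class_central x : x \in 'C_A[y] -> #|x ^: G| = 1%N.
Proof.
move=> /(subsetP cent1_sub_center)/centerP[Gx cxG].
apply/eqP; rewrite -index_cent1 indexg_eq1 subsetI subxx sub_cent1.
exact/centP.
Qed.

(** The centraliser of x contains A; it is not G because y is not in it, so it
    is A by maximality. *)
Lemma card_class_noncentral x : x \in A :\: 'C_A[y] -> #|x ^: G| = p.
Proof.
rewrite in_setD in_setI => /andP[+ Ax]; rewrite Ax /= => not_cyx.
rewrite -index_cent1 -iGA; congr #|_ : _|.
apply/eqP; rewrite eqEsubset andbC subsetI sAG sub_cent1 (subsetP cAA) //=.
apply: contraR not_cyx => not_sCA.
have : y \in 'C_G[x]; last by rewrite in_setI cent1C => /andP[].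
rewrite (prime_index_maximal (H := 'C_G[x]%G)) ?subsetIl //.
rewrite properE not_sCA andbT.
by rewrite subsetI sAG sub_cent1 (subsetP cAA).
Qed.

Lemma card_der1_cent1_prime_index : (#|G^`(1)| * #|'C_A[y]| = #|A|)%N.
Proof. exact: card_der1_cent1 cAA nAy join_cycle_prime_index. Qed.

(** 'C_G[y] contains y, so it supplements A in G, and the index of 'C_G[y] in G
    equals the index of 'C_A[y] in A. *)
Lemma card_class_outside : #|y ^: G| = #|G^`(1)|.
Proof.
have defAC : A * 'C_G[y] = G.
  apply/eqP; rewrite eqEsubset mul_subG ?subsetIl //=.
  rewrite -{1}join_cycle_prime_index norm_joinEr ?cycle_subG //.
  by rewrite mulgS // cycle_subG in_setI Gy cent1id.
have := mul_cardG A 'C_G[y]; rewrite /= defAC setIA (setIidPl sAG).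
rewrite -card_der1_cent1_prime_index -(Lagrange (subsetIl G 'C[y])) index_cent1.
rewrite -mulnA mulnAC [RHS]mulnC [(#|'C_A[y]| * _)%N]mulnC => /eqP.
by rewrite eqn_pmul2r ?muln_gt0 ?cardG_gt0 // => /eqP.
Qed.

End AbelianPrimeIndex.

(** Sum the indicator function of D over G, grouping the terms by classes. *)
Lemma card_classes_in (gT : finGroupType) (G : {group gT}) (D : {set gT})
    (k : nat) :
    D \subset G -> G \subset 'N(D)%g ->
    {in D, forall x, #|(x ^: G)%g| = k} ->
  (#|[set K in classes G | repr K \in D]| * k = #|D|)%N.
Proof.
move=> sDG nDG clD.
pose F x : int := (x \in D)%:R.
have FJ : {in G &, forall g h, F (g ^ h)%g = F g}.
  by move=> g h Gg Gh; rewrite /F memJ_norm // (subsetP nDG).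
have /eqP := sum_by_classes FJ.
have -> : \sum_(g in G) F g = #|D|%:R.
  rewrite -sum1_card natr_sum (big_setID D) /= (setIidPr sDG) addrC big1 ?add0r.
    by apply: eq_bigr => x Dx; rewrite /F Dx.
  by move=> x; rewrite inE /F => /andP[/negPf->].
have -> : \sum_(K in classes G) #|K|%:R * F (repr K)
   = (#|[set K in classes G | repr K \in D]| * k)%:R.
  rewrite -sum_nat_const natr_sum; under [RHS]eq_bigl do rewrite inE.
  rewrite big_mkcondr /=.
  apply: eq_bigr => K /repr_classesP[_ defK]; rewrite /F.
  case: ifP => [/clD <-|_]; last by rewrite mulr0.
  by rewrite mulr1 {1}defK.
by rewrite eqr_nat => /eqP.
Qed.

(** * Degrees of irreducible characters *)

Lemma lin_irr_charE (gT : finGroupType) (G : {group gT}) (i : Iirr G) :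
  ('chi_i \is a linear_char) = ('chi_i 1%g == 1).
Proof. by rewrite qualifE /= irr_char. Qed.

(** For a normal subgroup of prime index p, the restriction of an irreducible
    character is irreducible or a sum of p irreducible characters; those of A
    are all linear. *)
Lemma irr1_abelian_prime_index (gT : finGroupType) (A G : {group gT}) (p : nat)
    (i : Iirr G) :
    (A <| G)%g -> abelian A -> #|G : A|%g = p -> prime p ->
  'chi_i 1%g = if 'chi_i \is a linear_char then 1 else p%:R.
Proof.
move=> nsAG /char_abelianP linA iGA p_pr; rewrite lin_irr_charE.
have lin1 j : 'chi[A]_j 1%g = 1 by apply: lin_char1.
case: ifPn => [/eqP // | ].
case: (cfRes_prime_irr_cases i nsAG iGA p_pr) => [/irrP[j Dj]|[c _ Dc]].
  by rewrite -(cfRes1 A) Dj lin1 eqxx.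
rewrite -(cfRes1 A) Dc sum_cfunE; under eq_bigr do rewrite lin1.
by rewrite sumr_const card_ord.
Qed.

(** * Harada's number with an abelian normal subgroup of prime index *)

Section HaradaAbelianPrimeIndex.

Variables (gT : finGroupType) (A G : {group gT}) (p : nat).
Hypotheses (nsAG : (A <| G)%g) (cAA : abelian A).
Hypotheses (p_pr : prime p) (iGA : #|G : A|%g = p).

Lemma der1_sub_prime_index : (G^`(1) \subset A)%g.
Proof.
apply: der1_min; first exact: normal_norm.
by apply/cyclic_abelian/prime_cyclic; rewrite card_quotient ?iGA // normal_norm.
Qed.

(** The exponent is the number d of nonlinear irreducible characters, found by
    solving p |A : G'| + d p^2 = p |A|, the sum of the squared degrees. *)
Lemma prod_irr1_abelian_prime_index :
  \prod_(i : Iirr G) 'chi_i 1%g = (p ^ ((#|A| - #|A : G^`(1)|%g) %/ p))%:R.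
Proof.
have p_gt0 := prime_gt0 p_pr.
pose lin i := 'chi[G]_i \is a linear_char.
have chi1 i : 'chi[G]_i 1%g = if lin i then 1 else p%:R.
  exact: irr1_abelian_prime_index nsAG cAA iGA p_pr.
have -> : \prod_(i : Iirr G) 'chi_i 1%g = (p ^ #|[pred i | ~~ lin i]|)%:R.
  rewrite (bigID lin) /= big1 ?mul1r => [|i li]; last by rewrite chi1 li.
  rewrite natrX -prodr_const; apply: eq_bigr => i /negPf nli.
  by rewrite chi1 nli.
congr ((p ^ _)%:R); apply/esym.
suff <- : (#|[pred i | ~~ lin i]| * p = #|A| - #|A : G^`(1)|%g)%N.
  by rewrite mulnK.
have oG : #|G| = (#|A| * p)%N by rewrite -iGA Lagrange ?normal_sub.
have nlin : #|[pred i | lin i]| = (p * #|A : G^`(1)|%g)%N.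
  by rewrite card_lin_irr -iGA Lagrange_index ?der1_sub_prime_index ?normal_sub.
have : (#|G| = #|[pred i | lin i]| + #|[pred i | ~~ lin i]| * p * p)%N.
  apply/eqP; rewrite -(eqr_nat algC) -irr_sum_square (bigID lin) /= natrD.
  apply/eqP; congr (_ + _).
    rewrite -sum1_card natr_sum; apply: eq_bigr => i li.
    by rewrite chi1 li expr1n.
  rewrite -mulnA -sum_nat_const natr_sum; apply: eq_bigr => i /negPf nli.
  by rewrite chi1 nli natrM expr2.
rewrite oG nlin [(p * _)%N]mulnC -mulnDl => /eqP.
by rewrite eqn_pmul2r // => /eqP->; rewrite addKn.
Qed.

(** The first factor comes from the classes outside A, the second from those
    in A outside 'C_A[y], where y is any element of G outside A; classes in
    'C_A[y] have size 1. *)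
Lemma prod_card_classes_abelian_prime_index :
  (\prod_(K in classes G) #|K| =
    #|G^`(1)%g| ^ (p.-1 * #|A : G^`(1)|%g) *
    p ^ ((#|A| - #|A : G^`(1)|%g) %/ p))%N.
Proof.
have p_gt0 := prime_gt0 p_pr; have sAG := normal_sub nsAG.
have [y Gy notAy] : exists2 y, y \in G & y \notin A.
  by apply/subsetPn; rewrite -indexg_eq1 iGA neq_ltn prime_gt1 ?orbT.
have nCG : (G \subset 'N('C_A[y]))%g.
  rewrite cents_norm // centsC; apply: subset_trans (subsetIr G _).
  exact: cent1_sub_center nsAG cAA p_pr iGA Gy notAy.
have oA : #|A| = (#|G^`(1)%g| * #|A : G^`(1)|%g)%N.
  by rewrite Lagrange ?der1_sub_prime_index.
have oC : #|'C_A[y]%g| = #|A : G^`(1)|%g.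
  apply/eqP; rewrite -(eqn_pmul2l (cardG_gt0 (G^`(1))%g)) -oA.
  by rewrite (card_der1_cent1_prime_index nsAG cAA p_pr iGA Gy notAy).
have prodD (D : {set gT}) k : D \subset G -> (G \subset 'N(D))%g ->
    {in D, forall x, #|(x ^: G)%g| = k} -> (0 < k)%N ->
  (\prod_(K in classes G | repr K \in D) #|K| = k ^ (#|D| %/ k))%N.
  move=> sDG nDG clD k_gt0; rewrite -(card_classes_in sDG nDG clD) mulnK //.
  rewrite -prod_nat_const; apply: eq_big => [K|K]; first by rewrite inE.
  by case/andP=> /repr_classesP[_ {2}->] /clD.
have clout : {in G :\: A, forall x, #|(x ^: G)%g| = #|G^`(1)%g|}.
  move=> x /setDP[Gx nAx].
  exact: card_class_outside nsAG cAA p_pr iGA Gx nAx.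
have clin : {in A :\: 'C_A[y]%g, forall x, #|(x ^: G)%g| = p}.
  exact: card_class_noncentral.
have clZ : {in 'C_A[y]%g, forall x, #|(x ^: G)%g| = 1%N}.
  exact: card_class_central nsAG cAA p_pr iGA Gy notAy.
rewrite (bigID (fun K : {set gT} => repr K \in A)) [LHS]mulnC /=.
congr (_ * _)%N.
  rewrite (eq_bigl (fun K => (K \in classes G) && (repr K \in G :\: A))).
    rewrite (prodD _ _ _ _ clout) ?subsetDl ?cardG_gt0 //; last first.
      by rewrite normsD ?normG ?normal_norm.
    rewrite cardsDS // -(Lagrange sAG) iGA [(#|A| * p)%N]mulnC.
    by rewrite -[X in (_ - X)%N]mul1n -mulnBl subn1 oA mulnCA mulKn ?cardG_gt0.
  by move=> K; apply: andb_id2l => /repr_classesP[GK _]; rewrite inE GK andbT.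
rewrite (bigID (fun K : {set gT} => repr K \in 'C_A[y]%g)) [LHS]mulnC /=.
rewrite -[RHS]muln1; congr (_ * _)%N.
  rewrite (eq_bigl (fun K =>
    (K \in classes G) && (repr K \in A :\: 'C_A[y]%g))).
    rewrite (prodD _ _ _ _ clin) ?normsD ?(normal_norm nsAG) //; last first.
      by rewrite (subset_trans (subsetDl _ _)).
    by rewrite cardsDS ?subsetIl // oC.
  by move=> K; rewrite -andbA [in RHS]inE; congr andb; rewrite andbC.
by rewrite big1 // => K /andP[/andP[/repr_classesP[_ {3}->] _] /clZ].
Qed.

Theorem harada_abelian_prime_index :
  harada_number G = (#|G^`(1)%g| ^ (p.-1 * #|A : G^`(1)|%g))%:R.
Proof.
rewrite /harada_number prod_irr1_abelian_prime_index.
rewrite prod_card_classes_abelian_prime_index natrM mulfK //.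
by rewrite pnatr_eq0 -lt0n expn_gt0 prime_gt0.
Qed.

End HaradaAbelianPrimeIndex.

(** * Dihedral groups *)

Section Dihedral.

Variables (n : nat) (gT : finGroupType) (G : {group gT}).
Hypotheses (n_gt0 : (0 < n)%N) (dihG : dihedral n G).

Local Open Scope group_scope.

(** The relations alone bound the order from above only.  For the lower bound,
    a group of order 2n that satisfies them is a homomorphic image of G. *)
Lemma card_dihedral_ge : (n.*2 <= #|G|)%N.
Proof.
have [n_gt1 | n_le1] := ltnP 1 n.
  rewrite -(card_dihedral n_gt1); apply: leq_homg.
  by rewrite dihG -Grp_dihedral // homg_refl.
(* The groups 'D_m have the expected order only from 'D_4 on; for n = 1 the
   image is cyclic of order 2, with s trivial and t a generator. *)
have -> : n = 1%N by apply/eqP; rewrite eqn_leq n_le1.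
have <- : #|[set: 'Z_2]| = 1.*2 by rewrite cardsT card_ord.
apply: leq_homg; rewrite dihG; apply/existsP; exists (1, Zp1).
rewrite /= !xpair_eqE.
rewrite cycle1 joing1G expg1n conj1g invg1 !eqxx andbT Zp_cycle eqxx /=.
by apply/eqP/val_inj.
Qed.

Lemma dihedral_generators : exists x y : gT,
  [/\ <[x]> <*> <[y]> = G, x ^ y = x^-1, #[x] = n & #|G : <[x]>| = 2%N].
Proof.
have /existsP[[x y] /= /eqP[defG xn y2 xy]] := isoGrp_hom dihG.
exists x, y.
have nXY : <[y]> \subset 'N(<[x]>) by rewrite norms_cycle xy groupV cycle_id.
have x_le : (#[x] <= n)%N by rewrite dvdn_leq // order_dvdn xn.
have y_le : (#[y] <= 2)%N by rewrite dvdn_leq // order_dvdn y2.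
have oG : (#|G| * #|<[x]> :&: <[y]>| = #[x] * #[y])%N.
  by rewrite -defG norm_joinEr // -mul_cardG.
have ge2n := card_dihedral_ge; have I_gt0 := cardG_gt0 (<[x]> :&: <[y]>)%G.
(* From 2n <= |G| <= #[x] #[y] <= 2n all these bounds are attained. *)
have le2x : (#|G| <= #[x] * 2)%N.
  apply: leq_trans (leq_mul (leqnn _) y_le).
  by rewrite -oG leq_pmulr.
have ox : #[x] = n by lia.
have oG2 : #|G| = (#[x] * 2)%N by lia.
split=> //; rewrite -divgS; first by rewrite oG2 mulKn ?order_gt0.
by rewrite -defG joing_subl.
Qed.

End Dihedral.

Lemma der1_inverted_cycle (gT : finGroupType) (G : {group gT}) (x y : gT) :
  (<[x]> <*> <[y]> = G -> x ^ y = x^-1 -> G^`(1) = <[x ^+ 2]>)%g.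
Proof.
move=> defG xy.
have nXy : y \in 'N(<[x]>)%g.
  by rewrite -cycle_subG norms_cycle xy groupV cycle_id.
rewrite (der1_commg_imset (cycle_abelian x) nXy defG).
have comm_xi i : [~ x ^+ i, y]%g = ((x ^+ 2) ^- i)%g.
  by rewrite commgEl conjXg xy expgVn -expgM mul2n -addnn expgD invMg.
apply/setP=> z; apply/imsetP/idP => [[_ /cycleP[i ->] ->] | ].
  by rewrite comm_xi groupV mem_cycle.
rewrite -groupV => /cycleP[i zV]; exists (x ^+ i)%g; first exact: mem_cycle.
by rewrite comm_xi -zV invgK.
Qed.

Theorem proposition4p2 (n : nat) (n_gt0 : (0 < n)%N)
    (gT : finGroupType) (G : {group gT}) (dihG : dihedral n G) :
  if odd n then
    harada_number G = n%:R /\ n = #|G^`(1)%g|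
  else
    harada_number G = n%:R ^+ 2 / 4%:R
    /\ n%:R ^+ 2 / 4%:R = #|G^`(1)%g|%:R ^+ 2 :> algC.
Proof.
have [x [y [defG xy ox iGX]]] := dihedral_generators n_gt0 dihG.
have sXG : (<[x]> \subset G)%g by rewrite -defG joing_subl.
have oG' : #|G^`(1)%g| = (n %/ gcdn n 2)%N.
  by rewrite (der1_inverted_cycle defG xy) -orderE orderXgcd ox.
have nsXG := index2_normal sXG iGX.
have iXG' : #|<[x]> : G^`(1)|%g = gcdn n 2.
  rewrite -divgS ?(der1_sub_prime_index nsXG _ iGX) // -orderE ox oG'.
  by rewrite divnA ?dvdn_gcdl ?mulKn.
rewrite (harada_abelian_prime_index nsXG (cycle_abelian x) _ iGX) //.
rewrite iXG' oG' mul1n; case: ifP => n_odd.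
  have /eqP-> : coprime n 2 by rewrite coprimen2.
  by rewrite divn1 expn1.
have n_even : (2 %| n)%N by rewrite dvdn2 n_odd.
rewrite (gcdn_idPr n_even) natrX.
have -> : n%:R = (n %/ 2)%:R * 2 :> algC by rewrite -natrM divnK.
have -> : 4%:R = 2 ^+ 2 :> algC by rewrite -natrX.
by rewrite exprMn mulfK // expf_neq0 ?pnatr_eq0.
Qed.
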